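(* Let $\mathbb{S}=\mathbb{R}/2\pi\mathbb{Z}$ and, for $t\in\mathbb{S}$, let $$U_3(t)=\bigl(\cos t,\ \sin t,\ \cos 3t,\ \sin 3t,\ \cos 5t,\ \sin 5t\bigr)\in\mathbb{R}^6.$$ For a non-negative integer $m$, define $\Psi_m:\mathbb{S}\to\mathbb{R}^{6(m+1)}$ by $$\Psi_m(t)=\bigl(U_3(t),\ U_3(3t),\ \ldots,\ U_3(3^m t)\bigr).$$ Let $A_m\subset\mathbb{S}$ be the set of $4\cdot 3^{m+1}$ equally spaced points $$A_m=\left\{\frac{2\pi j}{4\cdot 3^{m+1}}:\ j=0,\ldots,4\cdot 3^{m+1}-1\right\},$$ and let $P_m=\operatorname{conv}\bigl(\Psi_m(t):\ t\in A_m\bigr)$. Then $P_m$ is a centrally symmetric polytope (i.e. $P_m=-P_m$) of dimension $d=4m+6$ that has exactly $4\cdot 3^{m+1}$ vertices, namely the points $\Psi_m(t)$ for $t\in A_m$. Moreover, for $t_1,t_2\in A_m$ with $t_1\neq t_2$ and $t_1\neq t_2+\pi \pmod{2\pi}$, the segment $[\Psi_m(t_1),\Psi_m(t_2)]$ is an edge of $P_m$.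
   Context: A polytope is the convex hull of finitely many points in $\mathbb{R}^d$. A face of a convex body is its intersection with a supporting affine hyperplane; an edge is a one-dimensional face. The dimension of a polytope is the dimension of its affine hull. *)

(* Defs.v *)
From HB Require Import structures.
From mathcomp Require Import all_boot all_order all_algebra.
From mathcomp Require Import classical_sets reals trigo.
Set Implicit Arguments. Unset Strict Implicit. Unset Printing Implicit Defensive.
Import Order.TTheory GRing.Theory Num.Theory.
Local Open Scope ring_scope.
Local Open Scope classical_set_scope.

Section Defs.
Variable R : realType.

Definition U3 (t : R) (r : nat) : R :=
  match r with
  | 0 => cos t | 1 => sin t
  | 2 => cos (3 * t) | 3 => sin (3 * t)
  | 4 => cos (5 * t) | _ => sin (5 * t)
  end.

Definition Psi (m : nat) (t : R) : 'rV[R]_(6 * m.+1) :=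
  \row_(k < 6 * m.+1) U3 ((3%:R ^+ (k %/ 6)) * t) (k %% 6).

Definition Npts (m : nat) : nat := 4 * 3 ^ m.+1.

Definition tA (m : nat) (j : 'I_(Npts m)) : R :=
  2 * pi * (j%:R) / (Npts m)%:R.

Definition conv (n k : nat) (v : 'I_k -> 'rV[R]_n) : set 'rV[R]_n :=
  [set x | exists l : 'I_k -> R,
     (forall i, 0 <= l i) /\ \sum_(i < k) l i = 1 /\ x = \sum_(i < k) l i *: v i].

Definition dotv (n : nat) (c x : 'rV[R]_n) : R := \sum_(i < n) c 0 i * x 0 i.

Definition is_face (n : nat) (P F : set 'rV[R]_n) : Prop :=
  exists (c : 'rV[R]_n) (b : R),
    c != 0 /\ (forall x, P x -> dotv c x <= b) /\
    (exists x, P x /\ dotv c x = b) /\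
    F = P `&` [set x | dotv c x = b].

Definition is_vertex (n : nat) (P : set 'rV[R]_n) (v : 'rV[R]_n) : Prop :=
  is_face P [set v].

Definition segment (n : nat) (p q : 'rV[R]_n) : set 'rV[R]_n :=
  [set x | exists s : R, 0 <= s <= 1 /\ x = (1 - s) *: p + s *: q].

(* edge = one-dimensional face; a segment [p,q] with p <> q is 1-dimensional *)
Definition is_edge (n : nat) (P : set 'rV[R]_n) (p q : 'rV[R]_n) : Prop :=
  p != q /\ is_face P (segment p q).

(* dimension of the affine hull of P equals d: the linear span of the
   differences x - y (x, y in P) has dimension d. *)
Definition affdim (n : nat) (P : set 'rV[R]_n) (d : nat) : Prop :=
  (exists x : 'I_d.+1 -> 'rV[R]_n, (forall i, P (x i)) /\
      \rank (\matrix_(i < d) (x (lift ord0 i) - x ord0)) = d) /\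
  (forall (k : nat) (x0 : 'rV[R]_n) (y : 'I_k -> 'rV[R]_n),
      P x0 -> (forall i, P (y i)) ->
      (\rank (\matrix_(i < k) (y i - x0)) <= d)%N).

End Defs.

(* Main.v *)
Require Import Defs.
From HB Require Import structures.
From mathcomp Require Import all_boot all_order all_algebra.
From mathcomp Require Import classical_sets reals trigo.
From mathcomp Require Import zify ring lra.
Set Implicit Arguments. Unset Strict Implicit. Unset Printing Implicit Defensive.
Import Order.TTheory GRing.Theory Num.Theory.
Local Open Scope ring_scope.
Local Open Scope classical_set_scope.

(* Up to repetition the coordinates of Psi_m are the cosines and sines of the
   frequencies 3^i (i <= m + 1) and 5 * 3^i (i <= m).  These 2m + 3 frequencies
   are odd, distinct and smaller than half of N = 4 * 3^(m+1), so their cosines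
   and sines are orthogonal on A_m, whence the dimension and the symmetry.
   A vertex t0 is exposed by cos (t - t0).  For an edge [t1, t2] with d = t1 - t2
   and u the midpoint, induct on n = m + 1, starting from the square n = 0 that
   carries only the frequency 1.  If cos 3d = -1, a combination of cos (t - u)
   and cos 3 (t - u) exposes the pair.  If cos 3d <> -1, first maximise a
   functional g (3 t) exposing 3 t1 and 3 t2 one level below; what remains is one
   or two cosets of the rotations by 2 pi / 3, and there the frequencies 1 and 5
   suffice to separate t1 and t2 from the other points. *)

(** * Trigonometric identities for multiple angles *)

Lemma sin_of_cos1 (R : realType) (a : R) : cos a = 1 -> sin a = 0.
Proof. by move=> ca; apply: cos1sin0; rewrite ca normr1. Qed.

(** The equation [cos a = 1] stands throughout for a = 0 modulo 2 pi. *)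
Lemma cosD_of_cos1 (R : realType) (a b : R) : cos a = 1 -> cos (a + b) = cos b.
Proof. by move=> ca; rewrite cosD ca (sin_of_cos1 ca) mul1r mul0r subr0. Qed.

Lemma cosB_sym (R : realType) (a b : R) : cos (a - b) = cos (b - a).
Proof. by rewrite -opprB cosN. Qed.

Lemma cos_double (R : realType) (x : R) : cos (2 * x) = 2 * cos x ^+ 2 - 1.
Proof. by rewrite mulr_natl cos_mulr2n; ring. Qed.

Lemma cos_triple (R : realType) (x : R) : cos (3 * x) = 4 * cos x ^+ 3 - 3 * cos x.
Proof.
have -> : 3 * x = 2 * x + x by ring.
rewrite cosD cos_double (mulr_natl x 2) sin_mulr2n.
have := sin2cos2 x; move: (sin x) (cos x) => s c sE.
have -> : (c * s) *+ 2 * s = 2 * c * s ^+ 2 by ring.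
by rewrite sE; ring.
Qed.

Lemma cos_quadruple (R : realType) (x : R) :
  cos (4 * x) = 8 * cos x ^+ 4 - 8 * cos x ^+ 2 + 1.
Proof.
have -> : 4 * x = 2 * (2 * x) by ring.
by rewrite !cos_double; ring.
Qed.

(** With c = cos x, the cubic 4 c^3 - 3 c - 1 factors as (c - 1) (2 c + 1)^2. *)
Lemma cos_triple1 (R : realType) (x : R) :
  cos (3 * x) = 1 -> cos x = 1 \/ cos x = - 2^-1.
Proof.
rewrite cos_triple => e.
have : (cos x - 1) * ((2 * cos x + 1) * (2 * cos x + 1)) = 0.
  by move: e; move: (cos x) => c e; lra.
move/eqP; rewrite !mulf_eq0 orbb => /orP[] /eqP ?; [left | right]; lra.
Qed.

Lemma cos_tripleN1 (R : realType) (x : R) :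
  cos (3 * x) = -1 -> cos x = -1 \/ cos x = 2^-1.
Proof.
move=> e; have [] := @cos_triple1 R (x + pi).
- have -> : 3 * (x + pi) = pi *+ 2 + (3 * x + pi) by ring.
  by rewrite cosD_of_cos1 ?cos2pi // cosDpi e opprK.
- by rewrite cosDpi => ?; left; lra.
- by rewrite cosDpi => ?; right; lra.
Qed.

(** With c the common cosine, (cos (a - b) - 1) (cos (a + b) - 1) equals (c^2 - 1)^2 - sin^2 a sin^2
    b, and both squared sines are 1 - c^2. *)
Lemma cos_eq_half (R : realType) (a b : R) :
  cos a = cos b -> cos (a - b) = 1 \/ cos (a + b) = 1.
Proof.
move=> e.
have h : (cos (a - b) - 1) * (cos (a + b) - 1) = 0.
  rewrite cosB cosD e.
  have := sin2cos2 a; have := sin2cos2 b; rewrite e.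
  move: (sin a) (sin b) (cos b) => u v c hv hu.
  have -> : (c * c + u * v - 1) * (c * c - u * v - 1) =
    (c ^+ 2 - 1) ^+ 2 - u ^+ 2 * v ^+ 2 by ring.
  by rewrite hu hv; ring.
by move/eqP: h; rewrite mulf_eq0 => /orP[] /eqP ?; [left | right]; lra.
Qed.

(* On the coset [3 x = 0 mod 2 pi], frequency 5 is frequency -1, so frequencies
   1 and 5 together can be matched to any prescribed direction. *)
Lemma freq15_coset (R : realType) (x e : R) : cos (3 * x) = 1 ->
  sin (5 * e) * cos (x + e) + sin e * cos (5 * (x + e)) = sin (6 * e) * cos x.
Proof.
move=> x3.
have -> : 5 * (x + e) = 3 * x + (3 * x + (5 * e - x)) by ring.
rewrite !(cosD_of_cos1 _ x3).
have -> : 6 * e = 5 * e + e by ring.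
by rewrite cosB cosD sinD; ring.
Qed.

(** * Frequencies and trigonometric polynomials *)

(** The two families are interleaved so that level n uses exactly the indices below 2n + 1 and a
    shift of the index by two is multiplication by 3. *)
Definition freq (a : nat) : nat := (3 ^ a./2 * (if odd a then 5 else 1))%N.

Lemma freqSS a : freq a.+2 = (3 * freq a)%N.
Proof. by rewrite /freq /= negbK expnS mulnA. Qed.

(** Trigonometric polynomials without constant term; the phase [phi] accounts for sines. Closure
    under pointwise equality avoids function extensionality. *)
Inductive trig_span (R : realType) (n : nat) : (R -> R) -> Prop :=
| trig_span_cos a c phi of (a < n.*2.+1)%N :
    trig_span n (fun t => c * cos ((freq a)%:R * t - phi))
| trig_spanD f g of trig_span n f & trig_span n g :
    trig_span n (fun t => f t + g t)
| trig_span_ext f g of trig_span n f & f =1 g : trig_span n g.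

Lemma trig_spanZ (R : realType) n (c : R) f :
  trig_span n f -> trig_span n (fun t => c * f t).
Proof.
elim=> [a d phi lt_a|{}f g _ ihf _ ihg|{}f g _ ih fg].
- apply: trig_span_ext (trig_span_cos (c * d) phi lt_a) _ => t.
  by rewrite mulrA.
- by apply: trig_span_ext (trig_spanD ihf ihg) _ => t; rewrite mulrDr.
- by apply: trig_span_ext ih _ => t; rewrite fg.
Qed.

(** Tripling the variable turns [freq a] into [freq a.+2]. *)
Lemma trig_span_triple (R : realType) n (f : R -> R) :
  trig_span n f -> trig_span n.+1 (fun t => f (3 * t)).
Proof.
elim=> [a d phi lt_a|{}f g _ ihf _ ihg|{}f g _ ih fg].
- have lt_a2 : (a.+2 < n.+1.*2.+1)%N by rewrite doubleS.
  apply: trig_span_ext (trig_span_cos d phi lt_a2) _ => t.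
  by rewrite freqSS natrM; congr (_ * cos (_ - _)); ring.
- exact: trig_spanD.
- by apply: trig_span_ext ih _ => t; rewrite fg.
Qed.

Lemma trig_span_base (R : realType) n (k : nat) (u : R) :
    k \in [:: 1%N; 3; 5] -> (k == 1%N) || (0 < n)%N ->
  trig_span n (fun t => cos (k%:R * (t - u))).
Proof.
move=> k135 kn.
have [a lt_a ka] : exists2 a, (a < n.*2.+1)%N & freq a = k.
  move: k135 kn; rewrite !inE; case/or3P=> /eqP -> /=.
  - by exists 0%N.
  - by exists 2%N => //; lia.
  - by exists 1%N => //; lia.
apply: trig_span_ext (trig_span_cos 1 (k%:R * u) lt_a) _ => t.
by rewrite ka mul1r; congr cos; ring.
Qed.

Lemma trig_span_cos1 (R : realType) n (u : R) :
  trig_span n (fun t => cos (t - u)).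
Proof.
by apply: trig_span_ext (@trig_span_base R n 1 u isT isT) _ => t; rewrite mul1r.
Qed.

(** * Functions exposing a pair of points *)

(** As the set is finite, a large M makes the deficit of [g] below [b] outweigh any excess of [h]
    over [c]: lexicographic maximisation by a single linear combination. *)
Lemma lex_max (R : realType) (T : eqType) (s : seq T) (g h : T -> R) (b c : R) :
    (forall t, t \in s -> g t <= b) ->
    (forall t, t \in s -> g t = b -> h t <= c) ->
  exists M, forall t, t \in s -> M * g t + h t <= M * b + c /\
    (M * g t + h t = M * b + c <-> g t = b /\ h t = c).
Proof.
move=> gb hc.
suff [M ltM] : exists M, forall t, t \in s -> g t < b ->
    M * g t + h t < M * b + c.
  exists M => t ts; have := gb t ts.
  rewrite le_eqVlt => /orP[/eqP gt | gt].
    have := hc t ts gt; rewrite gt; split; first lra.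
    by split=> [?|[_ ->]//]; split=> //; lra.
  have lt := ltM t ts gt; split; first lra.
  by split=> [?|[? _]]; lra.
elim: s {gb hc} => [|x s [M ihM]]; first by exists 0.
(* The quotient gives M (b - g x) >= |h x - c| + 1 at the new point; enlarging M preserves the
   earlier inequalities. *)
exists (Num.max M ((`|h x - c| + 1) / (b - g x))) => t.
rewrite inE => /predU1P[-> | ts] gt; last first.
  have := ihM t ts gt.
  have : M <= Num.max M ((`|h x - c| + 1) / (b - g x)) by rewrite le_max lexx.
  by move: (Num.max _ _) => N; nra.
have : (`|h x - c| + 1) / (b - g x) <= Num.max M ((`|h x - c| + 1) / (b - g x)).
  by rewrite le_max lexx orbT.
rewrite ler_pdivrMr; last by rewrite subr_gt0.
have := ler_norm (h x - c).
by move: (Num.max _ _) => N; nra.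
Qed.

(** Points are identified modulo 2 pi; taking t1 = t2 treats vertices by the same notion. *)
Definition exposes (R : realType) (s : seq R) (t1 t2 : R) (f : R -> R) (b : R) :=
  forall t, t \in s ->
    f t <= b /\ (f t = b <-> cos (t - t1) = 1 \/ cos (t - t2) = 1).

Lemma vertex_exposed (R : realType) n (s : seq R) (t0 : R) :
  exists f b, trig_span n f /\ exposes s t0 t0 f b.
Proof.
exists (fun t => cos (t - t0)), 1; split; first exact: trig_span_cos1.
move=> t _; split; first exact: cos_le1.
by split=> [->|[]//]; left.
Qed.

(** All differences are multiples of pi / 2, with cosine 1, 0 or -1; t1 and t2 are neighbours in the
    square, so cos (t1 - t2) = 0. *)
Lemma edge_square (R : realType) (s : seq R) (t1 t2 : R) :
    (forall t, t \in [:: t1, t2 & s] -> cos (4 * t) = 1) ->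
    cos (t1 - t2) != 1 -> cos (t1 - t2) != -1 ->
  exposes s t1 t2 (fun t => cos (t - t1) + cos (t - t2)) 1.
Proof.
move=> s4 d1 dN1.
have cosv t u : t \in [:: t1, t2 & s] -> u \in [:: t1, t2 & s] ->
    [\/ cos (t - u) = 1, cos (t - u) = 0 | cos (t - u) = -1].
  move=> /s4 t4 /s4 u4.
  have : cos (4 * (t - u)) = 1 by rewrite mulrBr cosB_sym -cosN opprB cosD_of_cos1 // cosN.
  rewrite cos_quadruple; move: (cos _) => c e.
  have : (c - 1) * (c * c * (c + 1)) = 0 by lra.
  move/eqP; rewrite !mulf_eq0 orbb => /or3P[] /eqP ?.
  - by constructor 1; lra.
  - by constructor 2.
  - by constructor 3; lra.
have m1 : t1 \in [:: t1, t2 & s] by rewrite !inE eqxx.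
have m2 : t2 \in [:: t1, t2 & s] by rewrite !inE eqxx orbT.
have d0 : cos (t1 - t2) = 0.
  by case: (cosv t1 t2 m1 m2) => // e; move: d1 dN1; rewrite e eqxx.
move=> t ts; have mt : t \in [:: t1, t2 & s] by rewrite !inE ts !orbT.
have h1 : cos (t - t1) = 1 -> cos (t - t2) = 0.
  move=> e; have -> : t - t2 = (t - t1) + (t1 - t2) by ring.
  by rewrite cosD_of_cos1.
have h2 : cos (t - t2) = 1 -> cos (t - t1) = 0.
  move=> e; have -> : t - t1 = (t - t2) + (t2 - t1) by ring.
  by rewrite cosD_of_cos1 // cosB_sym.
by case: (cosv t t1 mt m1) => [/[dup]/h1 -> ->|e1|e1];
  case: (cosv t t2 mt m2) => [/[dup]/h2|e2|e2]; rewrite ?e1 ?e2 => *;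
  (split; first lra); split=> [?|[]?]; first [lra | left; lra | right; lra].
Qed.

Lemma edge_short (R : realType) n (s : seq R) (t1 t2 : R) :
    cos (3 * (t1 - t2)) = -1 -> cos (t1 - t2) != -1 ->
  exists f b, trig_span n.+1 f /\ exposes s t1 t2 f b.
Proof.
move=> /cos_tripleN1[-> |d2 _]; first by rewrite eqxx.
pose r := cos ((t1 - t2) / 2); pose u := (t1 + t2) / 2.
have r2 : r ^+ 2 = 3 / 4.
  move: d2; have {1}-> : t1 - t2 = 2 * ((t1 - t2) / 2) by field.
  by rewrite cos_double -/r => ?; lra.
(* In x = cos (t - u) this is 9 r x - 4 r x^3, with derivative 12 r (r^2 - x^2) because r^2 = 3/4;
   the value at x = r is 9/2. The factor r allows for either sign of r. *)
exists (fun t => (6 * r) * cos (t - u) + (- r) * cos (3 * (t - u))), (9 / 2).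
split.
  apply: trig_spanD; apply: trig_spanZ; first exact: trig_span_cos1.
  by apply: trig_span_base; rewrite ?orbT.
move=> t _; rewrite cos_triple; set x := cos (t - u).
(* This keeps the factor r x + 3/2 below positive, so the maximum is attained only at x = r. *)
have xle : -1 < r * x.
  have : (r * x) ^+ 2 < 1.
    have := sin2cos2 (t - u); have := sqr_ge0 (sin (t - u)).
    by rewrite exprMn r2 -/x; lra.
  by nra.
(* Double root of the cubic at its maximum on [-1, 1]. *)
have fE : 6 * r * x + - r * (4 * x ^+ 3 - 3 * x) - 9 / 2 =
    - 4 * (x - r) ^+ 2 * (r * x + 3 / 2).
  have -> : - 4 * (x - r) ^+ 2 * (r * x + 3 / 2) = - 4 * r * x ^+ 3
     + (8 * r ^+ 2 - 6) * x ^+ 2 + (12 - 4 * r ^+ 2) * (r * x) - 6 * r ^+ 2 by field.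
  by rewrite r2; field.
have xr : x = r <-> cos (t - t1) = 1 \/ cos (t - t2) = 1.
  have e1 : t - t1 = t - u - (t1 - t2) / 2 by rewrite /u; field.
  have e2 : t - t2 = t - u + (t1 - t2) / 2 by rewrite /u; field.
  split; first by rewrite e1 e2; apply: cos_eq_half.
  case=> e.
  - have -> : x = cos ((t - t1) + (t1 - t2) / 2) by rewrite /x; congr cos; rewrite /u; field.
    by rewrite cosD_of_cos1.
  - have -> : x = cos ((t - t2) + - ((t1 - t2) / 2)) by rewrite /x; congr cos; rewrite /u; field.
    by rewrite cosD_of_cos1 // cosN.
rewrite -xr; have h : 0 <= (x - r) ^+ 2 := sqr_ge0 _.
split; first by nra.
split=> [e|->]; last by have := fE; nra.
have /eqP : (x - r) ^+ 2 * (r * x + 3 / 2) = 0 by lra.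
by rewrite mulf_eq0 expf_eq0 /= => /orP[] /eqP ?; lra.
Qed.

(** Here t1 - t2 is a third of a turn up to sign. Maximising cos 3 (t - t1) leaves the three points
    t1 + 2 pi k / 3, where cos (t - t1) + cos (t - t2) is 1/2 at t1 and t2 and -1 at the third. *)
Lemma edge_coset (R : realType) n (s : seq R) (t1 t2 : R) :
    cos (3 * (t1 - t2)) = 1 -> cos (t1 - t2) != 1 ->
  exists f b, trig_span n.+1 f /\ exposes s t1 t2 f b.
Proof.
move=> d3 d1; have d2 : cos (t1 - t2) = - 2^-1.
  by case: (cos_triple1 d3) => // e; rewrite e eqxx in d1.
pose g t := cos (3 * (t - t1)); pose h t := cos (t - t1) + cos (t - t2).
have hv t : g t = 1 -> h t <= 2^-1 /\
    (h t = 2^-1 <-> cos (t - t1) = 1 \/ cos (t - t2) = 1).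
  move=> x3; rewrite /h.
  have y3 : cos (3 * (t - t2)) = 1.
    have -> : 3 * (t - t2) = 3 * (t - t1) + 3 * (t1 - t2) by ring.
    by rewrite cosD_of_cos1.
  have h1 : cos (t - t1) = 1 -> cos (t - t2) = - 2^-1.
    move=> e; have -> : t - t2 = (t - t1) + (t1 - t2) by ring.
    by rewrite cosD_of_cos1.
  have h2 : cos (t - t2) = 1 -> cos (t - t1) = - 2^-1.
    move=> e; have -> : t - t1 = (t - t2) + (t2 - t1) by ring.
    by rewrite cosD_of_cos1 // cosB_sym.
  case: (cos_triple1 x3) (cos_triple1 y3) => [/[dup]/h1 -> ->|e1] [e2|e2];
  rewrite ?e1 ?e2; (split; first lra); split=> [?|[]?];
  first [lra | left; lra | right; lra].
have [||M HM] := @lex_max R R s g h 1 2^-1.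
- by move=> t _; apply: cos_le1.
- by move=> t _ /hv[].
exists (fun t => M * g t + h t), (M * 1 + 2^-1); split.
  apply: trig_spanD; first by apply/trig_spanZ/trig_span_base; rewrite ?orbT.
  by apply: trig_spanD; apply: trig_span_cos1.
move=> t ts; have [le eq] := HM t ts; split=> //; rewrite eq; split.
  by case=> /hv[_ <-].
have g1 : cos (t - t1) = 1 \/ cos (t - t2) = 1 -> g t = 1.
  rewrite /g; case=> e; first by rewrite cos_triple e; lra.
  have -> : 3 * (t - t1) = 3 * (t - t2) + - (3 * (t1 - t2)) by ring.
  by rewrite cosD_of_cos1 ?cosN // cos_triple e; lra.
by move=> e; have /hv[_ ->] := g1 e; split=> //; apply: g1.
Qed.

(** Maximising f (3 t) leaves the cosets of t1 and t2 under rotations by 2 pi / 3. The tie-breaker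
    [h] equals cos (t - t1) on the first and cos (t - t2) on the second, hence is 1 only at t1 and
    t2. *)
Lemma edge_lift (R : realType) n (s : seq R) (t1 t2 : R) f b :
    cos (3 * (t1 - t2)) != 1 -> cos (3 * (t1 - t2)) != -1 ->
    trig_span n f -> exposes [seq 3 * t | t <- s] (3 * t1) (3 * t2) f b ->
  exists f b, trig_span n.+1 f /\ exposes s t1 t2 f b.
Proof.
move=> d1 dN1 spf expf.
pose e := (t1 - t2) / 2; pose u := (t1 + t2) / 2; pose sn := sin (6 * e).
have eE : 3 * (t1 - t2) = 6 * e by rewrite /e; field.
rewrite eE in d1 dN1.
(* The divisor is sin 3 (t1 - t2), nonzero since the cosine of that angle is neither 1 nor -1. *)
have sn0 : sn != 0.
  apply: contraNneq d1 => s0; have := cos2Dsin2 (6 * e).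
  rewrite -/sn s0 expr0n addr0 => /eqP.
  by rewrite sqrf_eq1 (negPf dN1) orbF.
pose h t := (sin (5 * e) / sn) * cos (t - u) + (sin e / sn) * cos (5 * (t - u)).
have hv1 t : cos (3 * (t - t1)) = 1 -> h t = cos (t - t1).
  move=> x3; have := freq15_coset e x3.
  have -> : t - t1 + e = t - u by rewrite /e /u; field.
  by rewrite -/sn /h => E; rewrite mulrAC (mulrAC (sin e)) -mulrDl E; field.
have hv2 t : cos (3 * (t - t2)) = 1 -> h t = cos (t - t2).
  (* Replacing e by -e changes the sign of all three sines, so the same [h] serves both cosets. *)
  move=> x3; have := freq15_coset (- e) x3.
  have -> : t - t2 - e = t - u by rewrite /e /u; field.
  rewrite !mulrN !sinN !mulNr -opprD -/sn /h => /oppr_inj E.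
  by rewrite mulrAC (mulrAC (sin e)) -mulrDl E; field.
pose g t := f (3 * t).
have gv t : t \in s -> g t <= b /\
    (g t = b <-> cos (3 * (t - t1)) = 1 \/ cos (3 * (t - t2)) = 1).
  by move=> ts; rewrite !mulrBr; apply/expf/map_f.
have [||M HM] := @lex_max R R s g h b 1.
- by move=> t /gv[].
- by move=> t /gv[_ ->] [/hv1 -> | /hv2 ->]; apply: cos_le1.
exists (fun t => M * g t + h t), (M * b + 1); split.
  apply: trig_spanD; first exact/trig_spanZ/trig_span_triple.
  apply: trig_spanD; apply: trig_spanZ; first exact: trig_span_cos1.
  by apply: trig_span_base; rewrite ?orbT.
move=> t ts; have [le eq] := HM t ts; split=> //; rewrite eq.
have [_ ->] := gv t ts; split.
  by case=> [[/hv1 -> | /hv2 ->]]; [left | right].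
by case=> c1; [have x3 : cos (3 * (t - t1)) = 1 | have x3 : cos (3 * (t - t2)) = 1];
  rewrite ?(hv1 _ x3) ?(hv2 _ x3) ?cos_triple ?c1; first [lra | by split; [auto |]].
Qed.

Lemma edge_exposed (R : realType) n (s : seq R) (t1 t2 : R) :
    (forall t, t \in [:: t1, t2 & s] -> cos ((4 * 3 ^ n)%:R * t) = 1) ->
    cos (t1 - t2) != 1 -> cos (t1 - t2) != -1 ->
  exists f b, trig_span n f /\ exposes s t1 t2 f b.
Proof.
elim: n s t1 t2 => [|n IHn] s t1 t2 sn d1 dN1.
  exists (fun t => cos (t - t1) + cos (t - t2)), 1; split.
    by apply: trig_spanD; apply: trig_span_cos1.
  by apply: edge_square.
have [/edge_short h|c3N1] := eqVneq (cos (3 * (t1 - t2))) (-1); first exact: h.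
have [/edge_coset h|c31] := eqVneq (cos (3 * (t1 - t2))) 1; first exact: h.
have [||| f [b [spf expf]]] := IHn [seq 3 * t | t <- s] (3 * t1) (3 * t2).
- move=> _ /(@mapP _ _ (fun t => 3 * t) [:: t1, t2 & s])[t ts ->].
  by rewrite -[RHS](sn t ts) expnS (mulnCA 4) (natrM _ 3) mulrCA mulrA.
- by rewrite -mulrBr.
- by rewrite -mulrBr.
exact: edge_lift c31 c3N1 spf expf.
Qed.

(** * Linear functionals on convex hulls and their faces *)

Lemma dotvE (R : realType) n (c x : 'rV[R]_n) : dotv c x = (c *m x^T) 0 0.
Proof. by rewrite mxE; apply: eq_bigr => i _; rewrite mxE. Qed.

Lemma dotvDl (R : realType) n (c d x : 'rV[R]_n) :
  dotv (c + d) x = dotv c x + dotv d x.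
Proof. by rewrite !dotvE mulmxDl mxE. Qed.

Lemma dotvZl (R : realType) n a (c x : 'rV[R]_n) : dotv (a *: c) x = a * dotv c x.
Proof. by rewrite !dotvE -scalemxAl mxE. Qed.

Lemma dotvC (R : realType) n (c x : 'rV[R]_n) : dotv c x = dotv x c.
Proof. by apply: eq_bigr => i _; rewrite mulrC. Qed.

Lemma dotvDr (R : realType) n (c x y : 'rV[R]_n) :
  dotv c (x + y) = dotv c x + dotv c y.
Proof. by rewrite dotvC dotvDl !(dotvC c). Qed.

Lemma dotvZr (R : realType) n a (c x : 'rV[R]_n) : dotv c (a *: x) = a * dotv c x.
Proof. by rewrite dotvC dotvZl dotvC. Qed.

Lemma dotv_delta (R : realType) n i (x : 'rV[R]_n) : dotv (delta_mx 0 i) x = x 0 i.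
Proof. by rewrite dotvE -rowE !mxE. Qed.

Lemma dotv_comb (R : realType) n k (c : 'rV[R]_n) (l : 'I_k -> R) v :
  dotv c (\sum_(i < k) l i *: v i) = \sum_(i < k) l i * dotv c (v i).
Proof.
rewrite dotvE linear_sum mulmx_sumr summxE; apply: eq_bigr => i _.
by rewrite dotvE linearZ -scalemxAr mxE.
Qed.

Lemma conv_gen (R : realType) n k (v : 'I_k -> 'rV[R]_n) j : conv v (v j).
Proof.
exists (fun i => (i == j)%:R); split; first by move=> i; rewrite ler0n.
rewrite (bigD1 j) //= eqxx big1 ?addr0 => [|i /negPf ->] //; split=> //.
by rewrite (bigD1 j) //= eqxx scale1r big1 ?addr0 => [|i /negPf ->] //; rewrite scale0r.
Qed.

Lemma conv_seg (R : realType) n k (v : 'I_k -> 'rV[R]_n) i j :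
  segment (v i) (v j) `<=` conv v.
Proof.
move=> _ [s [/andP[s0 s1] ->]].
exists (fun h => (1 - s) * (h == i)%:R + s * (h == j)%:R).
have pick (T : lmodType R) (p : 'I_k) (F : 'I_k -> T) : \sum_h (h == p)%:R *: F h = F p.
  by rewrite (bigD1 p) //= eqxx scale1r big1 ?addr0 => [|h /negPf ->] //; rewrite scale0r.
have pickR p : \sum_(h < k) (h == p)%:R = 1 :> R.
  by rewrite -[RHS](pick R^o p (fun=> 1)); apply: eq_bigr => h _; rewrite [RHS]mulr1.
split; first by move=> h; rewrite addr_ge0 ?mulr_ge0 ?ler0n ?subr_ge0.
split; first by rewrite big_split /= -!mulr_sumr !pickR; ring.
under eq_bigr do rewrite scalerDl -!scalerA.
by rewrite big_split /= -!scaler_sumr !pick.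
Qed.

Lemma dotv_conv_le (R : realType) n k (v : 'I_k -> 'rV[R]_n) c b x :
  (forall i, dotv c (v i) <= b) -> conv v x -> dotv c x <= b.
Proof.
move=> cb [l [l0 [l1 ->]]]; rewrite dotv_comb -[b]mul1r -l1 mulr_suml.
by apply: ler_sum => i _; rewrite ler_wpM2l.
Qed.

(** The nonnegative terms [l h * (b - dotv c (v h))] sum to b - b = 0, so each vanishes. *)
Lemma dotv_conv_max (R : realType) n k (v : 'I_k -> 'rV[R]_n) c b (l : 'I_k -> R) :
    (forall i, dotv c (v i) <= b) -> (forall i, 0 <= l i) -> \sum_(i < k) l i = 1 ->
    dotv c (\sum_(i < k) l i *: v i) = b ->
  forall i, l i != 0 -> dotv c (v i) = b.
Proof.
move=> cb l0 l1 e i li.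
have s0 : \sum_(h < k) l h * (b - dotv c (v h)) = 0.
  under eq_bigr do rewrite mulrBr.
  by rewrite sumrB -mulr_suml l1 mul1r -dotv_comb e subrr.
have /eqP : l i * (b - dotv c (v i)) = 0.
  by apply: (psumr_eq0P _ s0) => // h _; rewrite mulr_ge0 ?subr_ge0.
by rewrite mulf_eq0 (negPf li) subr_eq0 => /eqP ->.
Qed.

Lemma segment_xx (R : realType) n (p : 'rV[R]_n) : segment p p = [set p].
Proof.
apply/seteqP; split=> [x [s [_ ->]]|_ ->] /=; first by rewrite -scalerDl subrK scale1r.
by exists 0; rewrite lexx ler01 scale0r addr0 subr0 scale1r.
Qed.

Lemma conv_face_segment (R : realType) n k (v : 'I_k -> 'rV[R]_n) c b i j :
    (forall h, dotv c (v h) <= b) -> dotv c (v i) = b -> dotv c (v j) = b ->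
    (forall h, dotv c (v h) = b -> h = i \/ h = j) ->
  conv v `&` [set x | dotv c x = b] = segment (v i) (v j).
Proof.
move=> cb ib jb eqb; apply/seteqP; split; last first.
  move=> x sx; split; first exact: conv_seg sx.
  case: sx => s [_ ->] /=.
  by rewrite dotvDr !dotvZr ib jb; ring.
move=> _ [[l [l0 [l1 ->]]] /= e].
have lz h : h != i -> h != j -> l h = 0.
  move=> hi hj; apply: contraNeq hi => /(dotv_conv_max cb l0 l1 e)/eqb[-> //|hj'].
  by rewrite hj' eqxx in hj.
(* Splitting off i and j from the sum requires distinct indices; for i = j the segment is a
   point. *)
have [ij|ij] := eqVneq i j.
  exists 0; rewrite lexx ler01 subr0 scale1r scale0r addr0; split=> //.
  have lz' h : h != i -> l h = 0 by move=> hi; apply: lz; rewrite -?ij.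
  rewrite (bigD1 i) //= big1 ?addr0 => [|h hi]; last by rewrite lz' ?scale0r.
  by move: l1; rewrite (bigD1 i) //= big1 ?addr0 => [-> | h /lz' //]; rewrite scale1r.
exists (l j); move: l1; rewrite (bigD1 i) // (bigD1 j) /= ?[j == i]eq_sym //.
rewrite big1 ?addr0 => [l1|h /andP[hi hj]]; last exact: lz.
split; first by have := l0 i; have := l0 j; lra.
rewrite (bigD1 i) // (bigD1 j) /= ?[j == i]eq_sym // big1 ?addr0.
  by rewrite -l1 addrK.
by move=> h /andP[hi hj]; rewrite lz ?scale0r.
Qed.

(** A generator of nonzero weight in x lies on the supporting hyperplane, where the face is the
    single point x. *)
Lemma vertex_of_conv (R : realType) n k (v : 'I_k -> 'rV[R]_n) x :
  is_vertex (conv v) x -> exists j, x = v j.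
Proof.
case=> c [b [_ [cb [_ fx]]]].
have [[l [l0 [l1 xE]]] xb] : (conv v `&` [set y | dotv c y = b]) x by rewrite -fx.
have [/existsP[j lj]|/existsPn lz] := boolP [exists j, l j != 0]; last first.
  by move/eqP: l1; rewrite big1 ?[0 == 1]eq_sym ?oner_eq0 // => i _; apply/eqP/negPn/lz.
have cbv h : dotv c (v h) <= b by apply/cb/conv_gen.
have vb : dotv c (v j) = b.
  by rewrite /= xE in xb; apply: dotv_conv_max cbv l0 l1 xb j lj.
have : (conv v `&` [set y | dotv c y = b]) (v j) by split; [exact: conv_gen |].
by rewrite -fx /= => <-; exists j.
Qed.

(** * Arithmetic of the frequencies and coordinates of [Psi] *)

Lemma freq_doubleD i j : freq (i.*2 + j) = (3 ^ i * freq j)%N.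
Proof. by rewrite /freq halfD odd_double doubleK /= add0n oddD odd_double expnD mulnA. Qed.

Lemma odd_freq a : odd (freq a).
Proof. by rewrite /freq oddM oddX orbT; case: (odd a). Qed.

(** The 3-adic valuation of [freq a] recovers [a./2], and the cofactor 1 or 5 the parity. *)
Lemma freq_inj : injective freq.
Proof.
move=> a b; rewrite -[a]odd_double_half -[b]odd_double_half.
rewrite ![(odd _ + _)%N]addnC !freq_doubleD.
have log3 i c : logn 3 (3 ^ i * freq (nat_of_bool c)) = i.
  by rewrite lognM ?expn_gt0 //; [rewrite pfactorK //; case: c => /=; rewrite ?addn0 | case: c].
move=> e; have := congr1 (logn 3) e; rewrite !log3 => h; move: e; rewrite h.
move/eqP; rewrite eqn_pmul2l ?expn_gt0 // => /eqP e.
by move: e; case: (odd a); case: (odd b).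
Qed.

(** The extreme cases are 6 * 3^m and 10 * 3^m against N = 12 * 3^m. The factor 2 keeps the sum of
    two frequencies below N. *)
Lemma freq_lt a m : (a < m.*2.+3 -> 2 * freq a < Npts m)%N.
Proof.
have e : (Npts m = 12 * 3 ^ m)%N by rewrite /Npts expnS mulnA.
have m0 : (0 < 3 ^ m)%N by rewrite expn_gt0.
rewrite e -[a]odd_double_half addnC freq_doubleD.
case: (odd a) (a./2) => i lt_a; rewrite /freq /=.
  by have : (3 ^ i <= 3 ^ m)%N; [rewrite leq_exp2l //|]; lia.
by have : (3 ^ i <= 3 ^ m.+1)%N; [rewrite leq_exp2l //|rewrite expnS]; lia.
Qed.

(* The pairwise distinct coordinates of [Psi m], as phase-shifted cosines. *)
Definition Phi (R : realType) m (t : R) : 'rV[R]_(4 * m + 6) :=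
  \row_k cos ((freq k./2)%:R * t - (odd k)%:R * (pi / 2)).

(** Block i of [Psi] has frequencies 3^i, 3^(i+1), 5 * 3^i, of indices 2i, 2i + 2, 2i + 1 in [freq];
    hence the permuted table. The offsets 4 and 5 already belong to the start of block i + 1. *)
Lemma U3_cos (R : realType) i r (t : R) : (r < 6)%N ->
  let k := (4 * i + nth 0 [:: 0; 1; 4; 5; 2; 3] r)%N in
  U3 (3%:R ^+ i * t) r = cos ((freq k./2)%:R * t - (odd k)%:R * (pi / 2)).
Proof.
have kE c : ((4 * i + c)./2 = i.*2 + c./2)%N /\ odd (4 * i + c) = odd c by lia.
case: r => [|[|[|[|[|[|//]]]]]] _ /=; case: (kE 0%N) => e0 o0; case: (kE 1%N) => e1 o1;
case: (kE 2%N) => e2 o2; case: (kE 3%N) => e3 o3; case: (kE 4%N) => e4 o4;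
case: (kE 5%N) => e5 o5; rewrite ?(e0, e1, e2, e3, e4, e5, o0, o1, o2, o3, o4, o5);
rewrite freq_doubleD /freq natrM natrX /= ?mul0r ?subr0 ?mul1r ?cosBpihalf.
all: by [congr cos; ring | congr sin; ring].
Qed.

Lemma Psi_Phi (R : realType) m (l : 'I_(6 * m.+1)) :
  exists k, forall t : R, Psi m t 0 l = Phi m t 0 k.
Proof.
have lt_l : (l %% 6 < 6)%N by rewrite ltn_pmod.
have lt_k : (4 * (l %/ 6) + nth 0 [:: 0; 1; 4; 5; 2; 3] (l %% 6) < 4 * m + 6)%N.
  have : (l %/ 6 <= m)%N by have := ltn_ord l; lia.
  by move: lt_l; move: (l %% 6)%N => [|[|[|[|[|[|//]]]]]] _ /=; lia.
by exists (Ordinal lt_k) => t; rewrite !mxE U3_cos.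
Qed.

Lemma Phi_Psi (R : realType) m (k : 'I_(4 * m + 6)) :
  exists l, forall t : R, Phi m t 0 k = Psi m t 0 l.
Proof.
suff [i [r [le_i lt_r kE]]] : exists i r,
    [/\ (i <= m)%N, (r < 6)%N & k = (4 * i + nth 0 [:: 0; 1; 4; 5; 2; 3] r)%N :> nat].
  have lt_l : (6 * i + r < 6 * m.+1)%N by lia.
  have [e1 e2] : ((6 * i + r) %/ 6 = i /\ (6 * i + r) %% 6 = r)%N by lia.
  by exists (Ordinal lt_l) => t; rewrite !mxE /= e1 e2 U3_cos // -kE.
have lt_k := ltn_ord k.
have [le_q|gt_q] := leqP (k %/ 4) m.
  have : (k %% 4 < 4)%N by rewrite ltn_pmod.
  case E : (k %% 4)%N => [|[|[|[|//]]]] _.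
  - by exists (k %/ 4)%N, 0%N; split=> //=; lia.
  - by exists (k %/ 4)%N, 1%N; split=> //=; lia.
  - by exists (k %/ 4)%N, 4%N; split=> //=; lia.
  - by exists (k %/ 4)%N, 5%N; split=> //=; lia.
(* The two coordinates of frequency 3^(m+1) occur only as entries 2 and 3 of the last block. *)
have [E|E] : k = (4 * m + 4)%N :> nat \/ k = (4 * m + 5)%N :> nat by lia.
- by exists m, 2%N.
- by exists m, 3%N.
Qed.

(** Expanding cos (w t - phi) uses cos w t and sin w t, the coordinates 2a and 2a + 1 of [Phi], each
    of which is a coordinate of [Psi]. *)
Lemma trig_span_dotv (R : realType) m (f : R -> R) : trig_span m.+1 f ->
  exists c, forall t, dotv c (Psi m t) = f t.
Proof.
elim=> [a d phi lt_a|{}f g _ [c cE] _ [c' cE']|{}f g _ [c cE] fg].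
- have lt0 : (a.*2 < 4 * m + 6)%N by lia.
  have lt1 : (a.*2.+1 < 4 * m + 6)%N by lia.
  have [l0 E0] := Phi_Psi R (Ordinal lt0); have [l1 E1] := Phi_Psi R (Ordinal lt1).
  exists ((d * cos phi) *: delta_mx 0 l0 + (d * sin phi) *: delta_mx 0 l1) => t.
  rewrite dotvDl !dotvZl !dotv_delta -E0 -E1 !mxE /= uphalf_double doubleK odd_double /=.
  by rewrite mul0r subr0 mul1r cosBpihalf cosB; ring.
- by exists (c + c') => t; rewrite dotvDl cE cE'.
- by exists c => t; rewrite cE.
Qed.

(** Every frequency is odd, so a half-turn negates each coordinate. *)
Lemma Psi_addpi (R : realType) m (t : R) : Psi m (t + pi) = - Psi m t.
Proof.
apply/rowP => l; have [k kE] := Psi_Phi R l; rewrite [RHS]mxE !kE !mxE.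
rewrite mulrDr addrAC (mulr_natl pi) (alternatingn (@cosDpi R)) -signr_odd odd_freq expr1.
by rewrite mulN1r.
Qed.

(** * The points of A_m on the circle *)

Lemma cos_eq1_small (R : realType) (x : R) : `|x| < 2 * pi -> cos x = 1 -> x = 0.
Proof.
move=> xlt; rewrite -cos_norm.
have -> : `|x| = 2 * (`|x| / 2) by field.
rewrite cos_double => e; apply/eqP; rewrite -normr_le0 leNgt; apply/negP => xgt.
have : 0 < sin (`|x| / 2) by apply: sin_gt0_pi; lra.
by have := sin2cos2 (`|x| / 2); nra.
Qed.

Lemma Npts_gt0 m : (0 < Npts m)%N.
Proof. by rewrite /Npts muln_gt0 expn_gt0. Qed.

Lemma tA_bounds (R : realType) m (j : 'I_(Npts m)) : 0 <= tA R j < 2 * pi.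
Proof.
have N0 : 0 < (Npts m)%:R :> R by rewrite ltr0n Npts_gt0.
have p0 := @pi_gt0 R.
have -> : 0 <= tA R j.
  apply: divr_ge0; last exact: ltW.
  by rewrite mulr_ge0 ?ler0n //; lra.
rewrite /tA ltr_pdivrMr // ltr_pM2l ?ltr_nat ?ltn_ord //; lra.
Qed.

Lemma tA_diff (R : realType) m (i j : 'I_(Npts m)) : `|tA R i - tA R j| < 2 * pi.
Proof. by have := tA_bounds R i; have := tA_bounds R j; rewrite ltr_norml; lra. Qed.

Lemma NptsM_tA (R : realType) m (j : 'I_(Npts m)) : (Npts m)%:R * tA R j = pi *+ 2 *+ j.
Proof.
have N0 : (Npts m)%:R != 0 :> R by rewrite pnatr_eq0 -lt0n Npts_gt0.
by rewrite /tA mulrC divfK // -[RHS]mulr_natr -(mulr_natl pi 2).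
Qed.

Lemma tA_inj (R : realType) m : injective (@tA R m).
Proof.
move=> i j /(congr1 (fun t => (Npts m)%:R * t)); rewrite !NptsM_tA.
have p0 : pi *+ 2 != 0 :> R by rewrite mulrn_eq0 /= gt_eqF // pi_gt0.
rewrite -!(mulr_natr (pi *+ 2)) => /(mulfI p0)/eqP.
by rewrite eqr_nat => /eqP/val_inj.
Qed.

Lemma cos_tAB1 (R : realType) m (i j : 'I_(Npts m)) : cos (tA R i - tA R j) = 1 -> i = j.
Proof.
by move/(cos_eq1_small (tA_diff R i j))/eqP; rewrite subr_eq0 => /eqP/tA_inj.
Qed.

Lemma cos_tABN1 (R : realType) m (i j : 'I_(Npts m)) : cos (tA R i - tA R j) = -1 ->
  exists k : int, tA R i = tA R j + pi + k%:~R * (2 * pi).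
Proof.
move=> e; have p0 := @pi_gt0 R.
have : cos (`|tA R i - tA R j| - pi) = 1.
  have := cosDpi (`|tA R i - tA R j| - pi).
  by rewrite subrK cos_norm e => /oppr_inj.
move/cos_eq1_small => h.
have /h/eqP : `| `|tA R i - tA R j| - pi | < 2 * pi.
  by rewrite ltr_norml; have := tA_diff R i j; have := normr_ge0 (tA R i - tA R j); lra.
rewrite subr_eq0 eqr_norml => /andP[/orP[] /eqP d _].
- by exists 0; rewrite mul0r; lra.
- by exists (-1); rewrite mulN1r; lra.
Qed.

(** * Discrete orthogonality and the dimension *)

(** Multiplication by sin x, with x = pi q / N in (0, pi), makes the sum telescope via 2 sin x cos y
    = sin (y + x) - sin (y - x); the end arguments differ by 2 pi q. *)
Lemma sum_cos_tA (R : realType) m q (phi : R) : (0 < q < Npts m)%N ->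
  \sum_(j < Npts m) cos (q%:R * tA R j - phi) = 0.
Proof.
case/andP=> q0 qN; have N0 := Npts_gt0 m.
have Nr : 0 < (Npts m)%:R :> R by rewrite ltr0n.
pose x : R := pi * q%:R / (Npts m)%:R.
have sx : sin x != 0.
  rewrite gt_eqF // sin_gt0_pi // divr_gt0 ?mulr_gt0 ?pi_gt0 ?ltr0n //=.
  by rewrite ltr_pdivrMr // ltr_pM2l ?pi_gt0 // ltr_nat.
apply: (mulfI sx); rewrite mulr0 mulr_sumr.
pose F j : R := sin ((2 * j%:R - 1) * x - phi).
have FE (j : 'I_(Npts m)) : sin x * cos (q%:R * tA R j - phi) = (F j.+1 - F j) / 2.
  have -> : q%:R * tA R j = 2 * j%:R * x by rewrite /tA /x; field; rewrite gt_eqF.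
  rewrite /F -(natr1 j).
  have -> : (2 * (j%:R + 1) - 1) * x - phi = (2 * j%:R * x - phi) + x by ring.
  have -> : (2 * j%:R - 1) * x - phi = (2 * j%:R * x - phi) - x by ring.
  by move: (_ * x - phi) => a; rewrite sinD sinB; field.
under eq_bigr do rewrite FE.
rewrite -mulr_suml -(big_mkord xpredT (fun j => F j.+1 - F j)) telescope_sumr //.
have -> : F (Npts m) = sin ((2 * 0%:R - 1) * x - phi + (pi *+ 2) *+ q).
  rewrite /F; congr sin; rewrite -(mulr_natr (pi *+ 2)) -(mulr_natl pi 2) /x.
  by field; rewrite gt_eqF.
by rewrite (periodicn (@sinD2pi R)) subrr mul0r.
Qed.

Lemma cosMcos (R : realType) (a b : R) :
  cos a * cos b = (cos (a - b) + cos (a + b)) / 2.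
Proof. by rewrite cosB cosD; field. Qed.

(** By product-to-sum, the sum of the frequencies lies strictly between 0 and N and contributes
    nothing. The difference contributes only when it is 0; then the phases differ by 0 or a
    quarter-turn, giving N / 2 or 0. *)
Lemma Phi_orthogonal (R : realType) m (k l : 'I_(4 * m + 6)) :
  \sum_(j < Npts m) Phi m (tA R j) 0 k * Phi m (tA R j) 0 l =
  (Npts m)%:R / 2 * (k == l)%:R.
Proof.
have fk : (2 * freq k./2 < Npts m)%N by apply: freq_lt; have := ltn_ord k; lia.
have fl : (2 * freq l./2 < Npts m)%N by apply: freq_lt; have := ltn_ord l; lia.
have gk : (0 < freq k./2)%N by rewrite odd_gt0 ?odd_freq.
pose ph (i : nat) : R := (odd i)%:R * (pi / 2).
pose S (a b : nat) : R :=
  \sum_(j < Npts m) cos ((freq a./2)%:R * tA R j - ph a - ((freq b./2)%:R * tA R j - ph b)).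
have S0 a b : (2 * freq a./2 < Npts m)%N -> (freq b./2 < freq a./2)%N -> S a b = 0.
  move=> fa ab; have q : (0 < freq a./2 - freq b./2 < Npts m)%N.
    by rewrite subn_gt0 ab (leq_ltn_trans (leq_subr _ _)) // (leq_ltn_trans _ fa) // leq_pmull.
  rewrite -[RHS](@sum_cos_tA R m _ (ph a - ph b) q).
  by apply: eq_bigr => j _; rewrite (natrB _ (ltnW ab)); congr cos; move: (ph a) (ph b) => *; ring.
have SC a b : S a b = S b a by apply: eq_bigr => j _; rewrite cosB_sym.
have -> : \sum_(j < Npts m) Phi m (tA R j) 0 k * Phi m (tA R j) 0 l = S k l / 2.
  under eq_bigr do rewrite !mxE cosMcos.
  rewrite -mulr_suml big_split /=; congr (_ / 2); rewrite -[RHS]addr0; congr (_ + _).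
  have q : (0 < freq k./2 + freq l./2 < Npts m)%N.
    by rewrite addn_gt0 gk /=; lia.
  rewrite -[RHS](@sum_cos_tA R m _ (ph k + ph l) q).
  by apply: eq_bigr => j _; rewrite natrD -/(ph k) -/(ph l); congr cos; move: (ph k) (ph l) => *; ring.
have [lt|lt|] := ltngtP (freq k./2) (freq l./2).
- rewrite SC S0 // mul0r; case: eqP => [kl|_]; last by rewrite mulr0.
  by rewrite kl ltnn in lt.
- rewrite S0 // mul0r; case: eqP => [kl|_]; last by rewrite mulr0.
  by rewrite kl ltnn in lt.
move/freq_inj => kl; rewrite mulrAC; congr (_ / 2).
have -> : S k l = \sum_(j < Npts m) cos (ph k - ph l).
  by apply: eq_bigr => j _; rewrite kl cosB_sym; congr cos; move: (ph k) (ph l) => *; ring.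
rewrite sumr_const card_ord -[LHS]mulr_natl; congr (_ * _).
have -> : (k == l) = (odd k == odd l).
  apply/eqP/eqP => [-> // | o]; apply: val_inj.
  by rewrite /= -[LHS]odd_double_half -[RHS]odd_double_half kl o.
rewrite /ph; case: (odd k) (odd l) => [] [] /=;
  by rewrite ?subrr ?cos0 // ?mul0r ?mul1r ?sub0r ?subr0 ?cosN cos_pihalf.
Qed.

Lemma Psi_factor (R : realType) m : exists B : 'M[R]_(4 * m + 6, 6 * m.+1),
  forall t, Psi m t = Phi m t *m B.
Proof.
have [s sE] : exists s : 'I_(6 * m.+1) -> 'I_(4 * m + 6),
    forall l (t : R), Psi m t 0 l = Phi m t 0 (s l).
  have /boolp.choice[s sE] := @Psi_Phi R m.
  by exists s.
exists (\matrix_(k, l) (k == s l)%:R) => t.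
apply/rowP => l; rewrite sE; move: (Phi m t) => p; rewrite mxE (bigD1 (s l)) //= mxE eqxx mulr1 big1 ?addr0 //.
by move=> k /negPf sk; rewrite mxE sk mulr0.
Qed.

(** V and W arise from each other by selecting columns, so their ranks agree, and W^T W = (N / 2) I
    gives W full column rank. *)
Lemma rank_Psi (R : realType) m :
  \rank (\matrix_(j < Npts m) Psi m (tA R j)) = (4 * m + 6)%N.
Proof.
set V := \matrix_j _; pose W := \matrix_(j < Npts m) Phi m (tA R j).
have [B BE] := Psi_factor R m; have /boolp.choice[s sE] := @Phi_Psi R m.
have VE : V = W *m B by apply/row_matrixP => j; rewrite row_mul !rowK BE.
have WE : W = V *m \matrix_(l, k) (l == s k)%:R.
  apply/matrixP => j k; rewrite /W [LHS]mxE [RHS]mxE sE (bigD1 (s k)) //=.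
  rewrite [X in _ * X + _]mxE eqxx mulr1 big1 ?addr0 => [|l /negPf sk].
    by rewrite /V mxE.
  by rewrite [X in _ * X]mxE sk mulr0.
have WW : W^T *m W = ((Npts m)%:R / 2)%:M.
  apply/matrixP => k l; rewrite !mxE -[RHS]mulr_natr -Phi_orthogonal.
  by apply: eq_bigr => j _; rewrite !mxE.
apply/eqP; rewrite eqn_leq; apply/andP; split.
  by rewrite VE (leq_trans (mxrankM_maxr _ _)) // rank_leq_row.
apply: (@leq_trans (\rank W)); last by rewrite WE mxrankM_maxl.
have WWr : \rank (W^T *m W) = (4 * m + 6)%N.
  rewrite WW -scalemx1 mxrank_scale_nz ?mxrank1 //.
  by rewrite mulf_neq0 ?invr_eq0 ?pnatr_eq0 // -lt0n Npts_gt0.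
by rewrite (leq_trans _ (mxrankM_maxr W^T W)) ?WWr.
Qed.

(** * Antipodes, exposed faces and the conclusion *)

(** N is even and j goes to j + N / 2 modulo N; the disjunction records whether the index wraps
    around. *)
Lemma tA_antipode (R : realType) m : exists2 s : 'I_(Npts m) -> 'I_(Npts m),
  involutive s & forall j, tA R (s j) = tA R j + pi \/ tA R j = tA R (s j) + pi.
Proof.
have N0 := Npts_gt0 m.
have [h Nh] : exists h, Npts m = (2 * h)%N.
  by exists (2 * 3 ^ m.+1)%N; rewrite /Npts mulnA.
pose s (j : 'I_(Npts m)) := Ordinal (ltn_pmod (j + h) N0).
have sE j : s j = (if (j < h)%N then j + h else j - h)%N :> nat.
  have := ltn_ord j; rewrite /=; move: (nat_of_ord j) => {}j; rewrite Nh.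
  case: (ltnP j h) => hj jN; first by rewrite modn_small //; lia.
  have -> : (j + h = (j - h) + 2 * h)%N by lia.
  by rewrite modnDr modn_small //; lia.
have hpi (i j : 'I_(Npts m)) : i = (j + h)%N :> nat -> tA R i = tA R j + pi.
  move=> ij; have Nr : (Npts m)%:R = 2 * h%:R :> R by rewrite Nh natrM.
  rewrite /tA ij Nr natrD; field.
  by rewrite pnatr_eq0 -lt0n; lia.
exists s => j.
  by apply: ord_inj; rewrite !sE; case: (ltnP j h) => ?; case: ltnP; have := ltn_ord j; lia.
have := sE j; case: ltnP => hj e; first by left; apply: hpi.
by right; apply: hpi; lia.
Qed.

Lemma Psi_tA_inj (R : realType) m : injective (fun j : 'I_(Npts m) => Psi m (tA R j)).
Proof.
move=> i j e; apply: (@cos_tAB1 R).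
have [c cE] := trig_span_dotv (trig_span_cos1 m.+1 (tA R j)).
by rewrite -cE e cE subrr cos0.
Qed.

Lemma exposed_face (R : realType) m (j1 j2 : 'I_(Npts m)) f b :
    let v := fun j : 'I_(Npts m) => Psi m (tA R j) in
    trig_span m.+1 f -> exposes [seq tA R j | j : 'I_(Npts m)] (tA R j1) (tA R j2) f b ->
    cos (tA R j1 - tA R j2) != -1 ->
  is_face (conv v) (segment (v j1) (v j2)).
Proof.
move=> v /trig_span_dotv[c cE] expf dN1.
have vE j : dotv c (v j) = f (tA R j) by rewrite cE.
have [fle feq] : (forall j, dotv c (v j) <= b) /\
    forall j, dotv c (v j) = b <-> j = j1 \/ j = j2.
  split=> j; have [le eq] := expf _ (fintype.image_f (@tA R m) (isT : j \in 'I_(Npts m)));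
    rewrite vE //.
  rewrite eq; split; first by case=> /cos_tAB1; [left | right].
  by case=> <-; rewrite subrr cos0; [left | right].
have f1 : dotv c (v j1) = b by apply/feq; left.
have f2 : dotv c (v j2) = b by apply/feq; right.
exists c, b; split; last first.
  split; first by move=> x; apply: dotv_conv_le.
  split; first by exists (v j1); split=> //; apply: conv_gen.
  by rewrite -(conv_face_segment fle f1 f2) // => h /feq.
(* A zero functional would put the antipode of j1 on the face as well, making it j1 or j2; the
   hypothesis on the cosine excludes the latter. *)
have [s _ sE] := tA_antipode R m.
have cs u : cos (tA R (s j1) - u) = - cos (tA R j1 - u).
  by case: (sE j1) => ->; rewrite addrAC cosDpi ?opprK.
apply/eqP => c0; have dot0 j : dotv c (v j) = 0 by rewrite c0 dotvE mul0mx mxE.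
have /feq[] : dotv c (v (s j1)) = b by rewrite -f1 !dot0.
- move=> e; have := cs (tA R j1); rewrite e subrr cos0 => ?; lra.
- move=> e; have := cs (tA R j2); rewrite e subrr cos0 => ?; case/eqP: dN1; lra.
Qed.

Theorem theorem1p2 (R : realType) (m : nat) :
  let v := fun j : 'I_(Npts m) => Psi m (tA R j) in
  let P := conv v in
  (forall x, P x <-> P (- x)) /\
  affdim P (4 * m + 6) /\
  [set x | is_vertex P x] = [set v j | j in [set: 'I_(Npts m)]] /\
  injective v /\
  (forall j1 j2 : 'I_(Npts m), j1 != j2 ->
     ~ (exists k : int, tA R j1 = tA R j2 + pi + k%:~R * (2 * pi)) ->
     is_edge P (v j1) (v j2)).
Proof.
move=> v P.
have [s sK sE] := tA_antipode R m.
have vs j : v (s j) = - v j.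
  by rewrite /v; case: (sE j) => ->; rewrite Psi_addpi ?opprK.
have symP x : P x -> P (- x).
  case=> l [l0 [l1 ->]]; exists (l \o s); split; first by move=> i; apply: l0.
  rewrite -l1 [RHS](reindex_inj (inv_inj sK)); split=> //.
  rewrite -sumrN (reindex_inj (inv_inj sK)); apply: eq_bigr => i _.
  by rewrite vs scalerN opprK.
split; first by move=> x; split=> /symP; rewrite ?opprK.
pose V := \matrix_(j < Npts m) v j.
split.
  split; last first.
    (* Upper bound: P, hence every difference, lies in the row space of V. *)
    have PV y : P y -> (y <= V)%MS.
      case=> l [_ [_ ->]]; apply: summx_sub => j _.
      by rewrite scalemx_sub // -(rowK v) row_sub.
    move=> k x0 y /PV x0V yP; rewrite -(rank_Psi R m); apply: mxrankS.
    apply/row_subP => i; rewrite rowK addmx_sub ?eqmx_opp //; exact: PV.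
  have := maxrowsub_free V; move: (maxrankfun V); rewrite (rank_Psi R m) => g /eqP gV.
  (* The base point, at [ord0], is the origin, the midpoint of two antipodal generators; the
     differences are then a maximal free family of rows of V. *)
  exists (fun i => if unlift ord0 i is Some h then v (g h) else 0); split.
    move=> i; case: unlift => [h|]; first exact: conv_gen.
    pose j := Ordinal (Npts_gt0 m).
    apply: (@conv_seg _ _ _ v j (s j)); exists 2^-1.
    split; first by apply/andP; split; lra.
    by rewrite vs scalerN -scalerBl (_ : 1 - _ - _ = 0) ?scale0r //; field.
  rewrite -[RHS]gV; congr mxrank; apply/row_matrixP => i.
  by rewrite rowK liftK unlift_none subr0 row_rowsub rowK.
split.
  apply/seteqP; split=> [x /vertex_of_conv[j ->]|_ [j _ <-]]; first by exists j.
  have [f [b [spf expf]]] := vertex_exposed m.+1 [seq tA R j | j : 'I_(Npts m)] (tA R j).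
  (* A vertex is treated as the degenerate segment with both ends v j. *)
  rewrite /= /is_vertex -segment_xx; apply: exposed_face spf expf _.
  by rewrite subrr cos0 gt_eqF //; lra.
split; first exact: Psi_tA_inj.
move=> j1 j2 j12 nopp.
have dN1 : cos (tA R j1 - tA R j2) != -1 by apply/eqP => /cos_tABN1.
split; first by apply: contra j12 => /eqP/Psi_tA_inj ->.
have [||| f [b [spf expf]]] :=
    @edge_exposed R m.+1 [seq tA R j | j : 'I_(Npts m)] (tA R j1) (tA R j2).
- have cN (j : 'I_(Npts m)) : cos ((Npts m)%:R * tA R j) = 1.
    by rewrite NptsM_tA -[X in cos X]add0r (@periodicn _ _ _ _ (@cosD2pi R)) cos0.
  by move=> t; rewrite !inE => /or3P[/eqP -> | /eqP -> | /fintype.imageP[j _ ->]]; apply: cN.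
- by apply: contra j12 => /eqP/cos_tAB1 ->.
- exact: dN1.
exact: exposed_face spf expf dN1.
Qed.
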